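(* Consider the fully discrete Voronoi finite volume scheme (implicit Euler in time, upwind four-point numerical flux) defined in the context, with homogeneous Neumann boundary data $j(x,t)=0$, no source or sink term, $f(x,t)=0$, and a nonnegative initial water height, i.e. $u_h^0\in W_h^0$ with $u_h^0(x_C)\ge b(x_C)$ for all $C\in\mathcal{C}_h$. Then the fully discrete solution $(u_h^n)_{n>0}$, if it exists, satisfies $$u_h^n(x_C)\ \ge\ b(x_C)\qquad \text{for all } n>0 \text{ and all } C\in\mathcal{C}_h^{iN}.$$
   Context: **Domain and data.** $\Omega\subset\mathbb{R}^2$ is a polygonal domain whose boundary consists of a Dirichlet part $\Gamma_D$ and a Neumann part $\Gamma_N$. The time interval $(t_0,t_0+T)$ is divided by $t_0=t^0<t^1<\dots<t^N=t_0+T$, with $\Delta t^n=t^n-t^{n-1}$. The scheme discretizes $\partial_t u+\nabla\cdot q=f$, $q=-K\,(u-b)^\alpha\|\nabla u\|^{-(1-\gamma)}\nabla u$, with $u=g$ on $\Gamma_D$ and $q\cdot n=j$ on $\Gamma_N$ ($n$ the unit outer normal). Here $u$ is the free surface elevation, $b$ the bathymetry and $u-b$ the water height. The parameters satisfy $\alpha\in(0,2]$, $\gamma\in(0,1]$; $K$ is a positive scalar function and $\epsilon>0$ is a fixed regularization constant. **Mesh.** $\mathcal{E}_h$ is a conforming mesh of open triangles partitioning $\Omega$ in which no triangle has an angle larger than $\pi/2$. Its vertices are $\mathcal{X}_h=\{x_1,\dots,x_M\}$. The set of cells is $\mathcal{C}_h=\{C_1,\dots,C_M\}$, where the Voronoi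 cell $C_m$ is the (open, polygonal) set of points of $\Omega$ closer to $x_m$ than to any other vertex; $x_m$ is called the center of $C_m$, and the center of a cell $C$ is written $x_C$. $|C|$ denotes the area of $C$. Put $\mathcal{C}_h^D=\{C\in\mathcal{C}_h:\partial C\cap\Gamma_D\ne\emptyset\}$ and $\mathcal{C}_h^{iN}=\mathcal{C}_h\setminus\mathcal{C}_h^D$. An interior edge is a line segment $F=\partial C\cap\partial C'$ (of positive length $|F|$) between two distinct cells; $\mathcal{F}_h^i$ is the set of interior edges. For each $F\in\mathcal{F}_h^i$ a unit normal $n_F$ is chosen, and $C_F^-,C_F^+$ are the two adjacent cells, with $n_F$ pointing from $C_F^-$ to $C_F^+$; $F$ lies on the perpendicular bisector of the segment joining $x_{C_F^-}$ and $x_{C_F^+}$. $x_F$ is the center of $F$. $\mathcal{F}_h^N$ is the set of Neumann boundary edges (line segments of $\partial C\cap\Gamma_N$, $C\in\mathcal{C}_h$), with center $x_F$ and length $|F|$. **Spaces and notation.** $W_h^0$ is the space of functions on $\Omega$ that are constant on each $C\in\mathcal{C}_h$; for $w\in W_h^0$, $w(x_C)$ denotes its constant value on $C$. $W_{h,0}^0=\{w\in W_h^0: w(x_C)=0\ \forall C\in\mathcal{C}_h^D\}$. It is assumed that $b\in W_h^0$. For $F\in\mathcal{F}_h^i$ and $w\in W_h^0$ the jump is $[\![w]\!](x_F)=w(x_{C_F^-})-w(x_{C_F^+})$. On boundary edges, $w(x_F)$ is the value of $w$ on the adjacent cell. $\Pi_h w$ is the continuous function, affine on each triangle of $\mathcal{E}_h$,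 that takes the value $w(x_m)$ at each vertex $x_m$. **Numerical flux.** For $F\in\mathcal{F}_h^i$ and $u_h=u_h^n\in W_h^0$ (the approximation at time $t^n$), set $$b_F=\max\big(b(x_{C_F^+}),b(x_{C_F^-})\big),\qquad H_F^\uparrow=\max\Big(\max\big(u_h(x_{C_F^+}),u_h(x_{C_F^-})\big)-b_F,\,0\Big),$$ and let $K_F=\dfrac{2K^-K^+}{K^-+K^+}$ be the harmonic average of the values $K^\pm$ of $K$ on the two sides of $F$. Let $E_{F,1},E_{F,2}\in\mathcal{E}_h$ be the two triangles adjacent to the mesh edge joining $x_{C_F^-}$ and $x_{C_F^+}$ (if that mesh edge lies on $\partial\Omega$ there is only one such triangle and the term of the missing one below is omitted), let $G_{F,i}=\|\nabla(\Pi_h u_h)|_{E_{F,i}}\|+\epsilon$ (Euclidean norm), and let $|F\cap E_{F,i}|$ be the length of the part of $F$ in $E_{F,i}$. The numerical flux at time $t^n$ is $$Q_F(t^n)=K_F\,(H_F^\uparrow)^\alpha\left(\frac{|F\cap E_{F,1}|}{(G_{F,1})^{1-\gamma}|F|}+\frac{|F\cap E_{F,2}|}{(G_{F,2})^{1-\gamma}|F|}\right)\frac{[\![u_h]\!](x_F)}{\|x_{C_F^+}-x_{C_F^-}\|}.$$ **Fully discrete scheme.** Given $u_h^{n-1}\in W_h^0$, $n>0$, find $u_h^n\in W_h^0$ with $u_h^n(x_C)=g(x_C,t^n)$ for all $C\in\mathcal{C}_h^D$ such that for all $w\in W_{h,0}^0$ $$\sum_{C\in\mathcal{C}_h^{iN}}u_h^n(x_C)w(x_C)|C|+\Delta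 t^n\sum_{F\in\mathcal{F}_h^i}Q_F(t^n)\,[\![w]\!](x_F)\,|F|=\sum_{C\in\mathcal{C}_h^{iN}}u_h^{n-1}(x_C)w(x_C)|C|+\Delta t^n\sum_{C\in\mathcal{C}_h^{iN}}f(x_C)w(x_C)|C|-\Delta t^n\sum_{F\in\mathcal{F}_h^N}j(x_F,t^n)w(x_F)|F|,$$ where $Q_F(t^n)$ is evaluated with $u_h=u_h^n$. A fully discrete solution is a sequence $(u_h^n)_{n=1,\dots,N}$ satisfying this for every $n$, starting from $u_h^0$. *)

(* Defs.v *)
From HB Require Import structures.
From mathcomp Require Import all_boot all_order all_algebra.
From mathcomp Require Import all_classical all_reals all_analysis.
Set Implicit Arguments.
Unset Strict Implicit.
Unset Printing Implicit Defensive.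
Import Order.TTheory GRing.Theory Num.Theory.
Import numFieldNormedType.Exports.
Local Open Scope classical_set_scope.
Local Open Scope ring_scope.

Notation point2 R := (R * R)%type.

Section PlaneGeometry.
Context {R : realType}.
Implicit Types (p q y : point2 R) (C : set (point2 R)).

(* The library norm on R * R is the sup norm, hence a separate Euclidean one. *)
Definition dot p q : R := p.1 * q.1 + p.2 * q.2.
Definition enorm p : R := Num.sqrt (dot p p).
Definition eudist p q : R := enorm (p - q).

Definition cross p q : R := p.1 * q.2 - p.2 * q.1.

(* Angle at p between the directions to q and y. *)
Definition angle p q y : R :=
  acos (dot (q - p) (y - p) / (enorm (q - p) * enorm (y - p))).

Definition bd C : set (point2 R) := closure C `\` interior C.

Definition segment p q : set (point2 R) :=
  [set y | exists s : R, 0 <= s <= 1 /\ y = p + s *: (q - p)].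

Definition open_segment p q : set (point2 R) :=
  [set y | exists s : R, 0 < s < 1 /\ y = p + s *: (q - p)].

Definition midpoint p q : point2 R := 2^-1 *: (p + q).

(* Length of the part of the segment [p, q] that lies in C. *)
Definition length_in p q C : R :=
  eudist p q *
  fine (lebesgue_measure [set s : R | 0 <= s <= 1 /\ C (p + s *: (q - p))]).

Definition area C : R :=
  fine ((lebesgue_measure \x lebesgue_measure)%E C).

Definition gradient (f : point2 R -> R) y : point2 R :=
  ('D_((1, 0) : point2 R) f y, 'D_((0, 1) : point2 R) f y).

Definition polygonal_domain (Om : set (point2 R)) : Prop :=
  [/\ Om !=set0, open Om, connected Om, bounded_set Om &
      exists s : seq (point2 R * point2 R),
        bd Om = [set y | exists2 pq, pq \in s & segment pq.1 pq.2 y]].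

End PlaneGeometry.

(* Choosing the normal n_F of an interior edge F amounts to choosing which of
   the two adjacent cells is C_F^-; this choice is given by em and ep. *)
Record mesh (R : realType) := Mesh {
  Omega : set (point2 R);
  GammaD : set (point2 R);
  GammaN : set (point2 R);
  nvert : nat;
  vert : 'I_nvert -> point2 R;
  tri : {set {set 'I_nvert}};   (* triangles, as their sets of vertices *)
  iedge : finType;              (* interior edges F = [ea F, eb F] *)
  em : iedge -> 'I_nvert;       (* C_F^- *)
  ep : iedge -> 'I_nvert;       (* C_F^+ *)
  ea : iedge -> point2 R;
  eb : iedge -> point2 R;
  nedge : finType;              (* Neumann edges F = [na F, nb F] *)
  nc : nedge -> 'I_nvert;       (* the cell adjacent to F *)
  na : nedge -> point2 R;
  nb : nedge -> point2 R
}.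

Section Mesh.
Context {R : realType} (D : mesh R).
Implicit Types (k l m : 'I_(nvert D)) (t : {set 'I_(nvert D)}).

Definition hull t : set (point2 R) :=
  [set y | exists c : 'I_(nvert D) -> R,
    [/\ forall i, i \in t -> 0 <= c i, \sum_(i in t) c i = 1 &
        y = \sum_(i in t) c i *: vert i]].

Definition open_hull t : set (point2 R) :=
  [set y | exists c : 'I_(nvert D) -> R,
    [/\ forall i, i \in t -> 0 < c i, \sum_(i in t) c i = 1 &
        y = \sum_(i in t) c i *: vert i]].

Definition barycenter t : point2 R := 3^-1 *: \sum_(i in t) vert i.

Record conforming_triangulation : Prop := {
  vert_inj : injective (@vert R D);
  tri_card : forall t, t \in tri D -> #|t| = 3%N;
  tri_nondeg : forall t i j k, t \in tri D -> i \in t -> j \in t -> k \in t ->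
    i != j -> j != k -> i != k ->
    cross (vert j - vert i) (vert k - vert i) != 0;
  tri_vert : forall m, exists2 t, t \in tri D & m \in t;
  tri_sub : forall t, t \in tri D -> open_hull t `<=` Omega D;
  tri_cover : closure (Omega D) = [set y | exists2 t, t \in tri D & hull t y];
  tri_conforming : forall t t', t \in tri D -> t' \in tri D ->
    hull t `&` hull t' = hull (t :&: t')
}.

Definition nonobtuse : Prop := forall t i j k,
  t \in tri D -> i \in t -> j \in t -> k \in t ->
  i != j -> j != k -> i != k -> angle (vert i) (vert j) (vert k) <= pi / 2.

Definition cell m : set (point2 R) :=
  [set y | Omega D y /\
           forall k, k != m -> eudist y (vert m) < eudist y (vert k)].

Definition dirichlet_cell m : bool := `[< bd (cell m) `&` GammaD D !=set0 >].

Record interior_edges : Prop := {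
  iedge_cells : forall F : iedge D, em F != ep F;
  iedge_segment : forall F : iedge D, ea F != eb F /\
    bd (cell (em F)) `&` bd (cell (ep F)) = segment (ea F) (eb F);
  iedge_all : forall k l, k != l ->
    (exists p q, p != q /\ bd (cell k) `&` bd (cell l) = segment p q) ->
    exists! F : iedge D, (em F = k /\ ep F = l) \/ (em F = l /\ ep F = k)
}.

(* Each (boundary of C) `&` GammaN is decomposed into non-overlapping segments,
   up to finitely many points, so that it is immaterial whether GammaN
   contains its end points. *)
Record neumann_edges : Prop := {
  nedge_neq : forall F : nedge D, na F != nb F;
  nedge_sub : forall F : nedge D,
    open_segment (na F) (nb F) `<=` bd (cell (nc F)) `&` GammaN D;
  nedge_disj : forall F F' : nedge D, F != F' -> nc F = nc F' ->
    open_segment (na F) (nb F) `&` open_segment (na F') (nb F') = set0;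
  nedge_cover : forall m,
    finite_set ((bd (cell m) `&` GammaN D) `\`
      [set y | exists F : nedge D,
                 nc F = m /\ open_segment (na F) (nb F) y])
}.

Record voronoi_mesh : Prop := {
  vm_domain : polygonal_domain (Omega D);
  vm_boundary : bd (Omega D) = GammaD D `|` GammaN D;
  vm_triangulation : conforming_triangulation;
  vm_nonobtuse : nonobtuse;
  vm_iedges : interior_edges;
  vm_nedges : neumann_edges
}.

Definition W0 (w : point2 R -> R) : Prop :=
  forall m, exists c : R, forall y, cell m y -> w y = c.

(* w(x_C) for C = cell m: the constant value of w on C.  It is not vert w at the
   center, which lies outside Omega when it is a boundary vertex. *)
Definition cval (w : point2 R -> R) m : R :=
  xget 0 [set c | forall y, cell m y -> w y = c].

Definition W00 (w : point2 R -> R) : Prop :=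
  W0 w /\ forall m, dirichlet_cell m -> cval w m = 0.

Definition jump (w : point2 R -> R) (F : iedge D) : R :=
  cval w (em F) - cval w (ep F).

Definition is_P1_interpolant (w p : point2 R -> R) : Prop :=
  [/\ {within closure (Omega D), continuous p},
      forall t, t \in tri D -> exists (a : point2 R) (c : R),
        forall y, open_hull t y -> p y = dot a y + c &
      forall m, p (vert m) = cval w m].

(* Unique on the closure of Omega. *)
Definition Pi_h (w : point2 R -> R) : point2 R -> R :=
  xget (fun=> 0) [set p | is_P1_interpolant w p].

(* The gradient of Pi_h w is constant on the open triangle t, so that it can be
   taken at the barycenter. *)
Definition grad_Pi_h (w : point2 R -> R) t : point2 R :=
  gradient (Pi_h w) (barycenter t).

Definition iedge_center (F : iedge D) : point2 R := midpoint (ea F) (eb F).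
Definition iedge_length (F : iedge D) : R := eudist (ea F) (eb F).
Definition nedge_center (F : nedge D) : point2 R := midpoint (na F) (nb F).
Definition nedge_length (F : nedge D) : R := eudist (na F) (nb F).

(* One-sided values of K at the center of F, as limits from inside the cells. *)
Definition has_side_values (K : point2 R -> R) : Prop :=
  forall F : iedge D,
    cvg (K y @[y --> within (cell (em F)) (nbhs (iedge_center F))]) /\
    cvg (K y @[y --> within (cell (ep F)) (nbhs (iedge_center F))]).

Definition K_minus (K : point2 R -> R) (F : iedge D) : R :=
  lim (K y @[y --> within (cell (em F)) (nbhs (iedge_center F))]).

Definition K_plus (K : point2 R -> R) (F : iedge D) : R :=
  lim (K y @[y --> within (cell (ep F)) (nbhs (iedge_center F))]).

Definition K_edge (K : point2 R -> R) (F : iedge D) : R :=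
  2 * K_minus K F * K_plus K F / (K_minus K F + K_plus K F).

Definition b_edge (b : point2 R -> R) (F : iedge D) : R :=
  Num.max (cval b (ep F)) (cval b (em F)).

Definition H_up (b u : point2 R -> R) (F : iedge D) : R :=
  Num.max (Num.max (cval u (ep F)) (cval u (em F)) - b_edge b F) 0.

(* The triangles adjacent to the mesh edge joining the centers of C_F^- and
   C_F^+ are those having both centers as vertices. *)
Definition flux (alpha gamma eps : R) (K b u : point2 R -> R) (F : iedge D) : R :=
  K_edge K F * (H_up b u F `^ alpha) *
  (\sum_(t in tri D | (em F \in t) && (ep F \in t))
      length_in (ea F) (eb F) (open_hull t) /
      ((enorm (grad_Pi_h u t) + eps) `^ (1 - gamma) * iedge_length F)) *
  (jump u F / eudist (vert (ep F)) (vert (em F))).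

(* One implicit Euler step of length dt from v to u, ending at time s. *)
Definition scheme_step (alpha gamma eps : R) (K b : point2 R -> R)
    (f g j : point2 R -> R -> R) (dt s : R) (v u : point2 R -> R) : Prop :=
  [/\ W0 u,
      forall m, dirichlet_cell m -> cval u m = g (vert m) s &
      forall w, W00 w ->
        \sum_(m | ~~ dirichlet_cell m) cval u m * cval w m * area (cell m)
        + dt * \sum_(F : iedge D)
                 flux alpha gamma eps K b u F * jump w F * iedge_length F
        = \sum_(m | ~~ dirichlet_cell m) cval v m * cval w m * area (cell m)
        + dt * \sum_(m | ~~ dirichlet_cell m)
                 f (vert m) s * cval w m * area (cell m)
        - dt * \sum_(F : nedge D)
                 j (nedge_center F) s * cval w (nc F) * nedge_length F].

Definition time_grid (t0 T : R) (N : nat) (time : nat -> R) : Prop :=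
  [/\ time 0%N = t0, time N = t0 + T &
      forall n, (n < N)%N -> time n < time n.+1].

Definition fully_discrete_solution (alpha gamma eps : R) (K b : point2 R -> R)
    (f g j : point2 R -> R -> R) (N : nat) (time : nat -> R)
    (u : nat -> point2 R -> R) : Prop :=
  forall n, (0 < n <= N)%N ->
    scheme_step alpha gamma eps K b f g j
      (time n - time n.-1) (time n) (u n.-1) (u n).

End Mesh.

(* Main.v *)
(* Test the scheme with w = min(u^n - b, 0) on the non-Dirichlet cells and 0 on
   the Dirichlet ones. By upwinding, a cell whose surface lies below its
   bathymetry can only receive water, so the flux term is nonnegative and
   \sum (u^n - u^(n-1)) w |C| <= 0. Since u^(n-1) >= b by induction, every term
   of this sum is nonnegative, and positive where w < 0 because cells have
   positive area; hence w = 0. *)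
Require Import Defs.
From mathcomp Require Import all_boot all_order all_algebra.
From mathcomp Require Import all_classical all_reals all_analysis.
From mathcomp Require Import lra.
Import Order.TTheory GRing.Theory Num.Theory.
Import numFieldNormedType.Exports.
Local Open Scope ring_scope.
Local Open Scope classical_set_scope.

(** * Euclidean distance, and area of bounded open sets *)

Section PlaneSets.
Context {R : realType}.
Implicit Types (C : set (R * R)) (p q : R * R).

Lemma enorm_ge0 p : 0 <= enorm p.
Proof. exact: sqrtr_ge0. Qed.

Lemma eudist_ge0 p q : 0 <= eudist p q.
Proof. exact: enorm_ge0. Qed.

Lemma eudist_diag p : eudist p p = 0.
Proof. by rewrite /eudist /enorm /dot subrr /= mulr0 addr0 sqrtr0. Qed.

Lemma eudist_gt0 p q : p != q -> 0 < eudist p q.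
Proof.
rewrite -subr_eq0 /eudist /enorm sqrtr_gt0 /dot -!expr2.
case: (p - q) => x y /= xy0.
rewrite lt0r addr_ge0 ?sqr_ge0// andbT paddr_eq0 ?sqr_ge0// !sqrf_eq0.
by apply: contra xy0 => /andP[/eqP-> /eqP->].
Qed.

Lemma eudist_continuous q : continuous (fun p => eudist p q).
Proof.
move=> p; rewrite /eudist /enorm /dot.
apply: (@continuous_comp _ _ _
  (fun p : R * R => (p - q).1 * (p - q).1 + (p - q).2 * (p - q).2) Num.sqrt);
  last exact: sqrt_continuous.
have c1 : {for p, continuous (fun p : R * R => (p - q).1)}.
  by apply: cvgB; [exact: cvg_fst|exact: cvg_cst].
have c2 : {for p, continuous (fun p : R * R => (p - q).2)}.
  by apply: cvgB; [exact: cvg_snd|exact: cvg_cst].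
by apply: cvgD; apply: cvgM.
Qed.

Let rat_box (q : (rat * rat) * (rat * rat)) : set (R * R) :=
  `]ratr q.1.1, ratr q.1.2[%classic `*` `]ratr q.2.1, ratr q.2.2[%classic.

(** Balls of the product norm are squares, so density of the rationals fits a rational box around
    each point of [C]. Boxes leaving [C] count as empty, which keeps the index set countable and
    independent of [C]. *)
Lemma open_bigcup_rat_box C : open C ->
  C = \bigcup_q (if `[< rat_box q `<=` C >] then rat_box q else set0).
Proof.
move=> oC; apply/seteqP; split=> [y Cy|y [q _]]; last first.
  by case: asboolP => // qC yq; exact: qC.
have /nbhs_ballP[e /= e0 yeC] : nbhs y C by exact: open_nbhs_nbhs.
have nearby x : exists q : rat * rat, ratr q.1 < x < ratr q.2 /\
    forall z : R, ratr q.1 < z < ratr q.2 -> x - e < z < x + e.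
  have xe : x - e < x by rewrite gtrBl.
  have ex : x < x + e by rewrite ltrDl.
  have [q1] := rat_in_itvoo xe; have [q2] := rat_in_itvoo ex.
  rewrite !in_itv /= => /andP[xq2 q2e] /andP[eq1 q1x].
  exists (q1, q2); rewrite /= q1x xq2; split=> // z /andP[q1z zq2].
  by rewrite (lt_trans eq1 q1z) (lt_trans zq2 q2e).
have [q1 [yq1 q1e]] := nearby y.1; have [q2 [yq2 q2e]] := nearby y.2.
exists (q1, q2) => //; case: asboolP => [_|].
  by split; rewrite /= in_itv.
case=> z [/=]; rewrite !in_itv /= => zq1 zq2; apply: yeC.
by split; rewrite /= ball_itv /= in_itv; [exact: q1e|exact: q2e].
Qed.

Lemma open_measurable_plane C : open C ->
  measurable (C : set (measurableTypeR R * measurableTypeR R)).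
Proof.
move=> /open_bigcup_rat_box ->; apply: countable_bigcupT_measurable => // q.
by case: ifP => _ //; apply: measurableX; exact: measurable_itv.
Qed.

(** Since [fine] sends an infinite measure to 0, an upper bound is needed too: [C] is squeezed
    between two squares. *)
Lemma area_gt0 C : open C -> bounded_set C -> C !=set0 -> 0 < area C.
Proof.
move=> oC bC [y Cy].
pose mu := @lebesgue_measure R.
have mC := open_measurable_plane C oC.
have box (z : R * R) (r : R) : 0 < r ->
    (mu \x mu)%E (ball z.1 r `*` ball z.2 r) = ((r *+ 2) * (r *+ 2))%:E.
  move=> r0; rewrite product_measure1E; [|by rewrite ball_itv; exact: measurable_itv..].
  rewrite EFinM; have r0' := ltW r0.
  by congr (_ * _)%E; exact: lebesgue_measure_ball.
have mbox (z : R * R) (r : R) : measurable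
    (ball z.1 r `*` ball z.2 r : set (measurableTypeR R * measurableTypeR R)).
  by apply: measurableX; rewrite ball_itv; exact: measurable_itv.
have /nbhs_ballP[e /= e0 yeC] : nbhs y C by exact: open_nbhs_nbhs.
have [M [Mreal CM]] := bC.
(* The bound [M] only controls [C] through numbers above [M], such as [|M| + 1]; one more unit makes
   the inequality strict. *)
pose r := `|M| + 2.
have r0 : 0 < r by rewrite ltr_wpDl.
have Cr : C `<=` ball (0 : R * R).1 r `*` ball (0 : R * R).2 r.
  move=> z Cz.
  have zM : `|z| <= `|M| + 1 by apply: CM => //; rewrite ltr_pwDr// ler_norm.
  have zr : `|z| < r by apply: le_lt_trans zM _; rewrite ltrD2l ltr1n.
  by split; rewrite /= -ball_normE /ball_ /= sub0r normrN;
    apply: le_lt_trans zr; rewrite prod_normE le_max lexx ?orbT.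
have lo : (((e *+ 2) * (e *+ 2))%:E <= (mu \x mu)%E C)%E.
  rewrite -(box y e e0).
  by apply: (le_measure (mu \x mu)%E); rewrite ?inE//.
have up : ((mu \x mu)%E C <= ((r *+ 2) * (r *+ 2))%:E)%E.
  rewrite -(box 0 r r0).
  by apply: (le_measure (mu \x mu)%E); rewrite ?inE//.
rewrite /area; apply: fine_gt0; apply/andP; split.
  by apply: lt_le_trans lo; rewrite lte_fin mulr_gt0// mulrn_wgt0.
by apply: le_lt_trans up _; rewrite ltry.
Qed.

Lemma length_in_ge0 p q C : 0 <= length_in p q C.
Proof. by rewrite mulr_ge0 ?eudist_ge0 ?fine_ge0. Qed.

End PlaneSets.

(** * Voronoi cells and functions with prescribed cell values *)

Section Cells.
Context {R : realType} (D : mesh R).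
Implicit Types (m k : 'I_(nvert D)) (w : R * R -> R).

(** Finitely many strict inequalities between continuous functions persist nearby. [Omega] is left
    out so that [y] may be a vertex on the boundary. *)
Lemma near_closer_vert y m :
  (forall k, k != m -> eudist y (vert m) < eudist y (vert k)) ->
  \forall z \near y, forall k, k != m -> eudist z (vert m) < eudist z (vert k).
Proof.
move=> ym.
apply: (@filter_forall (R * R)%type 'I_(nvert D)
  (fun k z => k != m -> eudist z (vert m) < eudist z (vert k)) _ (nbhs_filter y)) => k.
have [->|km] := eqVneq k m; first by apply: nearW.
have cont : {for y, continuous (fun z => eudist z (vert k) - eudist z (vert m))}.
  by apply: cvgB; exact: eudist_continuous.
have pos : 0 < eudist y (vert k) - eudist y (vert m) by rewrite subr_gt0 ym.
have : \forall z \near y, 0 < eudist z (vert k) - eudist z (vert m).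
  exact: (cont _ (lt_nbhsr pos)).
by apply: filterS => z; rewrite subr_gt0.
Qed.

Lemma cell_open m : open (Omega D) -> open (cell m).
Proof.
move=> oO; rewrite openE => y [Oy ym].
have nO : nbhs y (Omega D) by exact: open_nbhs_nbhs.
by apply: filterS2 nO (near_closer_vert y m ym) => z Oz zm; split.
Qed.

(* The points of a triangle at the vertex x_m that are close to x_m lie in the
   cell of x_m. *)
Lemma cell_nonempty m : conforming_triangulation D -> cell m !=set0.
Proof.
move=> hD; have [t tD mt] := tri_vert hD m.
pose bar := barycenter t.
pose z (s : R) : R * R := vert m + s *: (bar - vert m).
have zopen s : 0 < s < 1 -> open_hull t (z s).
  (* Barycentric coordinates of [z s]: each vertex gets [s / 3] from the barycenter, and [m] gets
     [1 - s] more. *)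
  case/andP=> s0 s1; exists (fun i => (1 - s) * (i == m)%:R + s / 3); split.
  - move=> i _; apply: ltr_wpDl; last by rewrite divr_gt0.
    by rewrite mulr_ge0// subr_ge0 ltW.
  - rewrite big_split /= -mulr_sumr sumr_const (tri_card hD tD).
    rewrite (bigD1 m)//= eqxx big1 => [|i /andP[_ /negbTE->]//].
    by rewrite addr0 mulr1 -mulr_natr; lra.
  - under [RHS]eq_bigr do rewrite scalerDl.
    rewrite [RHS]big_split /= -scaler_sumr.
    have -> : \sum_(i in t) ((1 - s) * (i == m)%:R) *: vert i =
        (1 - s) *: vert m.
      rewrite (bigD1 m)//= eqxx mulr1 big1 ?addr0// => i /andP[_ /negbTE->].
      by rewrite mulr0 scale0r.
    rewrite /z /bar /barycenter -scalerA scalerBr scalerBl scale1r.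
    by rewrite -addrA [in LHS](addrC (_ *: _)).
have zc : z s @[s --> 0^'+] --> vert m.
  apply: cvg_at_right_filter.
  rewrite -[X in _ --> X]addr0 -(scale0r (bar - vert m)).
  by apply: cvgD; [exact: cvg_cst|apply: cvgZr_tmp; exact: cvg_id].
have near_m : \forall y \near vert m,
    forall k, k != m -> eudist y (vert m) < eudist y (vert k).
  apply: near_closer_vert => k km; rewrite eudist_diag eudist_gt0//.
  by apply: contra_neq km => /(vert_inj hD).
have /= near_z := zc _ near_m.
near (0 : R)^'+ => s; exists (z s); split; last by near: s.
apply: (tri_sub hD tD); apply: zopen; apply/andP; split; near: s.
  exact: nbhs_right_gt.
exact: nbhs_right_lt.
Unshelve. all: by end_near. Qed.

Lemma cell_disjoint m k y : cell m y -> cell k y -> m = k.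
Proof.
move=> [_ ym] [_ yk]; apply/eqP/negP => /negP mk.
by have := lt_trans (ym k _) (yk m mk); rewrite eq_sym mk ltxx => /(_ isT).
Qed.

(** On an empty cell every constant would qualify; a point of the cell pins down the one chosen by
    [xget]. *)
Lemma cval_eq w m c : cell m !=set0 -> (forall y, cell m y -> w y = c) ->
  cval w m = c.
Proof.
move=> [y ym] wc; rewrite /cval; case: xgetP => [d _ wd|/(_ c)//].
by rewrite -(wd y ym) (wc y ym).
Qed.

(** Supplies the test function of the scheme. Disjointness of the cells makes the value at a point
    independent of the cell chosen to contain it. *)
Lemma W0_cval_surj (c : 'I_(nvert D) -> R) : conforming_triangulation D ->
  exists2 w, W0 D w & forall m, cval w m = c m.
Proof.
move=> hD; pose w y := if pselect (exists m, cell m y) is left e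
  then c (projT1 (cid e)) else 0.
have wE m y : cell m y -> w y = c m.
  rewrite /w => ym; case: pselect => [e|/(_ (ex_intro _ m ym))//].
  by case: cid => k yk /=; rewrite (cell_disjoint _ _ _ yk ym).
exists w => m; first by exists (c m) => y; exact: wE.
by apply: cval_eq; [exact: cell_nonempty|exact: wE].
Qed.

Lemma cell_area_gt0 m : voronoi_mesh D -> 0 < area (cell m).
Proof.
move=> hD; have [_ oO _ bO _] := vm_domain hD; apply: area_gt0.
- exact: cell_open.
- have [M [Mreal OM]] := bO.
  by exists M; split=> // M' MM' y [Oy _]; exact: OM.
- by apply: cell_nonempty; exact: vm_triangulation.
Qed.

End Cells.

(** * Sign of the numerical flux against a test function *)

Section Flux.
Context {R : realType} (D : mesh R).
Variables (alpha gamma eps : R) (K b u : R * R -> R).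
Hypothesis hK : forall y, Omega D y -> 0 < K y.

(** Membership in the closure makes the filter proper. Positivity of [K] passes to the limit only as
    a weak inequality. *)
Lemma lim_within_cell_ge0 m y : closure (cell m) y ->
  cvg (K z @[z --> within (cell (D := D) m) (nbhs y)]) ->
  0 <= lim (K z @[z --> within (cell (D := D) m) (nbhs y)]).
Proof.
move=> ym cK.
have PF : ProperFilter (within (cell (D := D) m) (nbhs y)).
  exact: within_nbhs_proper.
apply: limr_ge => //; apply: (@nearW _ (nbhs y)) => z [Oz _].
by rewrite ltW// hK.
Qed.

(** The center of [F] lies on the boundary of both cells, so both side values are nonnegative. If
    both vanish, the quotient is 0 by the convention on division by zero. *)
Lemma K_edge_ge0 (F : iedge D) : interior_edges D -> has_side_values D K ->
  0 <= K_edge K F.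
Proof.
move=> hF /(_ F)[cm cp].
have [_ Fseg] := iedge_segment hF F.
have : segment (ea F) (eb F) (iedge_center F).
  exists 2^-1; split; first by apply/andP; split; lra.
  rewrite /iedge_center /midpoint scalerBr scalerDr.
  have {2}-> : ea F = 2^-1 *: ea F + 2^-1 *: ea F.
    by rewrite -scalerDl [X in X *: _](_ : _ = 1) ?scale1r//; lra.
  by rewrite addrACA subrr addr0.
rewrite -Fseg => -[[clm _] [clp _]].
have Km := lim_within_cell_ge0 _ _ clm cm.
have Kp := lim_within_cell_ge0 _ _ clp cp.
by rewrite /K_edge divr_ge0 ?addr_ge0 ?mulr_ge0.
Qed.

(* If the flux through F does not vanish, the higher of the two adjacent free
   surfaces lies above both bathymetries, so that the side lying below its
   bathymetry, if any, is the lower one and receives water. *)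
Lemma flux_jump_ge0 (F : iedge D) (w : 'I_(nvert D) -> R) :
  interior_edges D -> has_side_values D K -> alpha != 0 ->
  (forall m, w m <= 0) -> (forall m, cval b m < cval u m -> w m = 0) ->
  0 <= flux alpha gamma eps K b u F * (w (em F) - w (ep F)).
Proof.
move=> hF hKside alpha0 wle0 weq0.
rewrite /flux; set S := \sum_(t in _ | _) _.
have S0 : 0 <= S.
  apply: sumr_ge0 => t _.
  by rewrite divr_ge0 ?length_in_ge0// mulr_ge0 ?powR_ge0 ?eudist_ge0.
have K0 := K_edge_ge0 F hF hKside.
have [H0|H0] := leP (H_up b u F) 0.
  have -> : H_up b u F = 0 by apply/le_anti; rewrite H0 le_max lexx orbT.
  (* A dry edge carries no flux: 0 to the power [alpha] is 0 because [alpha] is nonzero. *)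
  by rewrite powR0// mulr0 !mul0r.
have wet : Num.max (cval b (ep F)) (cval b (em F)) <
           Num.max (cval u (ep F)) (cval u (em F)).
  by move: H0; rewrite /H_up /b_edge lt_max ltxx orbF subr_gt0.
rewrite -mulrA; apply: mulr_ge0.
  by apply: mulr_ge0 S0; exact: mulr_ge0 K0 (powR_ge0 _ _).
rewrite mulrAC; apply: mulr_ge0; last by rewrite invr_ge0 eudist_ge0.
move: wet; rewrite /jump gt_max.
(* As [w] vanishes on the higher side, its difference reduces to the lower value, up to sign, and
   [w <= 0] gives it the sign of the jump of [u]. *)
have [upm|ump] := leP (cval u (ep F)) (cval u (em F)) => /andP[bp bm].
  by rewrite (weq0 (em F))// sub0r mulr_ge0 ?subr_ge0 ?oppr_ge0.
by rewrite (weq0 (ep F))// subr0 mulr_le0// subr_le0 ltW.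
Qed.

End Flux.

(** * One implicit Euler step, then induction over the time steps *)

Lemma scheme_step_height_ge0 (R : realType) (D : mesh R) (alpha gamma eps : R)
    (K b : R * R -> R) (f g j : R * R -> R -> R) (dt s : R) (v u : R * R -> R) :
  voronoi_mesh D -> alpha != 0 -> (forall y, Omega D y -> 0 < K y) ->
  has_side_values D K -> (forall y s, f y s = 0) -> (forall y s, j y s = 0) ->
  0 <= dt ->
  (forall m : 'I_(nvert D), ~~ dirichlet_cell m -> cval b m <= cval v m) ->
  scheme_step D alpha gamma eps K b f g j dt s v u ->
  forall m : 'I_(nvert D), ~~ dirichlet_cell m -> cval b m <= cval u m.
Proof.
move=> hD alpha0 hK hKside hf hj dt0 bv [_ _ hstep] m mD.
pose c (k : 'I_(nvert D)) : R :=
  if dirichlet_cell k then 0 else Num.min (cval u k - cval b k) 0.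
have [w wW0 wc] := W0_cval_surj D c (vm_triangulation hD).
have cD k : dirichlet_cell k -> c k = 0 by rewrite /c => ->.
have cle0 k : c k <= 0.
  by rewrite /c; case: ifP => // _; rewrite ge_min lexx orbT.
have ceq0 k : cval b k < cval u k -> c k = 0.
  by move=> bu; rewrite /c; case: ifP => // _; apply: min_r; rewrite subr_ge0 ltW.
have wW00 : W00 D w by split=> // k kD; rewrite wc cD.
have := hstep w wW00.
under [X in _ = _ + _ * X - _]eq_bigr do rewrite hf !mul0r.
under [X in _ = _ - _ * X]eq_bigr do rewrite hj !mul0r.
rewrite !big1_eq !mulr0 addr0 subr0 => heq.
have flux_ge0 : 0 <= dt * \sum_(F : iedge D)
    flux alpha gamma eps K b u F * jump w F * iedge_length F.
  apply: mulr_ge0 => //; apply: sumr_ge0 => F _; rewrite mulr_ge0 ?eudist_ge0//.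
  by rewrite /jump !wc; apply: flux_jump_ge0 => //; exact: vm_iedges.
pose d k := (cval u k - cval v k) * c k * area (cell k).
have d_ge0 k : ~~ dirichlet_cell k -> 0 <= d k.
  move=> kD; rewrite /d mulr_ge0//; last by rewrite ltW ?cell_area_gt0.
  (* Where [u <= b], the bound [b <= v] makes both [u - v] and [c] nonpositive; elsewhere [c] is
     0. *)
  have := bv k kD; rewrite /c (negbTE kD) => bvk.
  have [ub|ub] := leP (cval u k - cval b k) 0; last by rewrite mulr0.
  by rewrite mulr_le0//; lra.
have d_sum : \sum_(k : 'I_(nvert D) | ~~ dirichlet_cell k) d k <= 0.
  have -> : \sum_(k : 'I_(nvert D) | ~~ dirichlet_cell k) d k =
      \sum_(k : 'I_(nvert D) | ~~ dirichlet_cell k) cval u k * cval w k * area (cell k) -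
      \sum_(k : 'I_(nvert D) | ~~ dirichlet_cell k) cval v k * cval w k * area (cell k).
    by rewrite -sumrB; apply: eq_bigr => k _; rewrite /d wc !mulrBl.
  by rewrite -heq opprD addrA subrr sub0r oppr_le0.
have d0 : \sum_(k : 'I_(nvert D) | ~~ dirichlet_cell k) d k = 0.
  by apply/le_anti; rewrite d_sum sumr_ge0.
have /eqP := psumr_eq0P d_ge0 d0 mD.
(* If [u < b] in cell [m], then [u < v] and [c < 0] there, so [d m] would be nonzero. *)
rewrite leNgt; apply: contraTN => ub; have bvm := bv m mD.
rewrite /d /c (negbTE mD) min_l ?subr_le0 ?(ltW ub)//.
apply: mulf_neq0; last by rewrite gt_eqF// cell_area_gt0.
by apply: mulf_neq0; rewrite lt_eqF//; lra.
Qed.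

Local Close Scope classical_set_scope.

Theorem theorem3p1 (R : realType) (D : mesh R) (hD : voronoi_mesh D)
  (t0 T : R) (N : nat) (time : nat -> R) (hT : 0 < T)
  (htime : time_grid t0 T N time)
  (alpha gamma eps : R)
  (halpha : 0 < alpha <= 2) (hgamma : 0 < gamma <= 1) (heps : 0 < eps)
  (K : R * R -> R) (hK : forall y, Omega D y -> 0 < K y)
  (hKside : has_side_values D K)
  (b : R * R -> R) (hb : W0 D b)
  (f g j : R * R -> R -> R)
  (hf : forall y s, f y s = 0) (hj : forall y s, j y s = 0)
  (u : nat -> R * R -> R)
  (hu0 : W0 D (u 0%N)) (hu0b : forall m : 'I_(nvert D), cval b m <= cval (u 0%N) m)
  (hu : fully_discrete_solution D alpha gamma eps K b f g j N time u) :
  forall (n : nat) (m : 'I_(nvert D)), (0 < n <= N)%N ->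
    ~~ dirichlet_cell m -> cval b m <= cval (u n) m.
Proof.
have [_ _ time_incr] := htime.
have alpha0 : alpha != 0 by case/andP: halpha => /gt_eqF->.
(* The induction starts at [n = 0] and is confined to non-Dirichlet cells: on the others [u n]
   equals [g], which is not assumed to lie above [b]. *)
suff height n : (n <= N)%N -> forall m : 'I_(nvert D),
    ~~ dirichlet_cell m -> cval b m <= cval (u n) m.
  by move=> n m /andP[_ nN]; exact: height.
elim: n => [_ m _|n IHn nN]; first exact: hu0b.
apply: (scheme_step_height_ge0 _ _ _ _ _ _ _ _ _ _ _ _ _ _
  hD alpha0 hK hKside hf hj _ _ (hu n.+1 _)) => //.
  by rewrite subr_ge0 ltW ?time_incr.
by apply: IHn; exact: ltnW.
Qed.
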